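(* Consider rational $c$ for which $f_c(x)=x^2+c$ has a rational $3$-cycle $\{x_1,x_2,x_3\}$ (elements written in lowest terms). (a) Some $x_i$ has numerator $\pm1$ if and only if $c\in\{-\tfrac{29}{16},\,-\tfrac{29\cdot1709}{2^6\cdot3^2\cdot7^2}\}$. (b) Some $x_i$ has numerator $\pm5$ if and only if $c\in\{-\tfrac{29}{16},\,-\tfrac{301}{2^4\cdot3^2}\}$. (c) Some $x_i$ has numerator $\pm7$ if and only if $c\in\{-\tfrac{29}{16},\,-\tfrac{6469}{2^4\cdot3^2\cdot5^2}\}$. *)

(* Defs.v *)
From mathcomp Require Import all_boot all_order all_algebra.
Set Implicit Arguments. Unset Strict Implicit. Unset Printing Implicit Defensive.
Import Order.TTheory GRing.Theory Num.Theory.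
Local Open Scope ring_scope.

Definition fc (c x : rat) : rat := x ^+ 2 + c.

Definition is_3cycle (c x1 x2 x3 : rat) : Prop :=
  [/\ fc c x1 = x2, fc c x2 = x3, fc c x3 = x1 &
      [/\ x1 != x2, x2 != x3 & x1 != x3]].

Definition has_numer (k : int) (x : rat) : Prop := numq x = k \/ numq x = - k.

Definition some_numer (k : int) (x1 x2 x3 : rat) : Prop :=
  has_numer k x1 \/ has_numer k x2 \/ has_numer k x3.

(* Main.v *)
(* A rational 3-cycle is determined by t = x1 + x2: the middle point is
   (t^3 - t - 1) / (2 t (t + 1)), so for t = m / n in lowest terms its numerator is, up to sign,
   the norm of m - n th in Z[th], where th^3 = th + 1.  Its units are the +-th^k, and multiplying by
   a power of th moves the real embedding into [1, th]; this leaves finitely many elements of norm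
   1, 5 or 7, all of them associated to 1, 2 - th or 3 - 2 th.  So m - n th = p th^k with p one of
   these, and k is a zero of a ternary linear recurrence.  Skolem's method with th^58 = 1 mod 59
   (59 splits completely) finds all zeros, since each residue class mod 58 contains at most one.

   Conversely, s = x1 + x2 + x3 satisfies s^2 + s + c + 2 = 0, so c leaves two values of s; for each
   of the four c, one value gives a cubic for t without a root mod 11 and the other one splits. *)
Require Import Defs.
From Stdlib Require Import ZArith Reals Lra Lia List.

(** * The ring Z[th] *)

Module CubicRing.
Local Open Scope bool_scope.
Local Open Scope Z_scope.

(* [Elt a b c] is a + b th + c th^2. *)
Record elt := Elt { c0 : Z; c1 : Z; c2 : Z }.

Definition cst (z : Z) : elt := Elt z 0 0.
Definition add (x y : elt) : elt := Elt (c0 x + c0 y) (c1 x + c1 y) (c2 x + c2 y).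
Definition opp (x : elt) : elt := Elt (- c0 x) (- c1 x) (- c2 x).
Definition sub (x y : elt) : elt := add x (opp y).
(** [d3] and [d4] are the coefficients of th^3 and th^4 in the product, reduced by th^3 = 1 + th and
    th^4 = th + th^2. *)
Definition mul (x y : elt) : elt :=
  let d3 := c1 x * c2 y + c2 x * c1 y in
  let d4 := c2 x * c2 y in
  Elt (c0 x * c0 y + d3) (c0 x * c1 y + c1 x * c0 y + d3 + d4)
      (c0 x * c2 y + c1 x * c1 y + c2 x * c0 y + d4).
(** The product of the three conjugates; on m - n th it is m^3 - m n^2 - n^3. *)
Definition norm (x : elt) : Z :=
  let a := c0 x in let b := c1 x in let c := c2 x in
  a*a*a + b*b*b + c*c*c + 2*a*a*c + a*c*c - a*b*b - b*c*c - 3*a*b*c.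

Lemma elt_ring : ring_theory (cst 0) (cst 1) add mul sub opp eq.
Proof.
split; intros; repeat match goal with x : elt |- _ => destruct x end;
  unfold sub, mul, add, opp, cst; cbn [c0 c1 c2]; f_equal; ring.
Qed.
Add Ring elt_ring : elt_ring.

Lemma cst_add (a b : Z) : cst (a + b) = add (cst a) (cst b).
Proof. reflexivity. Qed.

Lemma cst_mul (a b : Z) : cst (a * b) = mul (cst a) (cst b).
Proof. unfold cst, mul; cbn [c0 c1 c2]; f_equal; ring. Qed.

Lemma c2_add (x y : elt) : c2 (add x y) = c2 x + c2 y.
Proof. reflexivity. Qed.

Lemma c2_cst_mul (a : Z) (x : elt) : c2 (mul (cst a) x) = a * c2 x.
Proof. unfold mul, cst; cbn [c0 c1 c2]; ring. Qed.

Lemma norm_mul (x y : elt) : norm (mul x y) = norm x * norm y.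
Proof. destruct x, y; unfold norm, mul; simpl c0; simpl c1; simpl c2; ring. Qed.

Definition th : elt := Elt 0 1 0.
(** th (th^2 - 1) = th^3 - th = 1. *)
Definition thinv : elt := Elt (-1) 0 1.

Definition thpow (k : Z) : elt :=
  match k with
  | Z0 => cst 1
  | Zpos p => Pos.iter (mul th) (cst 1) p
  | Zneg p => Pos.iter (mul thinv) (cst 1) p
  end.

Lemma th_thinv : mul th thinv = cst 1.
Proof. reflexivity. Qed.

Lemma thpow_succ (k : Z) : thpow (Z.succ k) = mul th (thpow k).
Proof.
destruct k as [|p|p].
- reflexivity.
- simpl. rewrite Pos.add_1_r, Pos.iter_succ. reflexivity.
- destruct (Pos.succ_pred_or p) as [->|E]; [reflexivity|].
  rewrite <- E at 2. simpl thpow at 2. rewrite Pos.iter_succ.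
  replace (Z.succ (Z.neg p)) with (Z.neg (Pos.pred p)) by lia.
  simpl. transitivity (mul (mul th thinv) (Pos.iter (mul thinv) (cst 1) (Pos.pred p))).
  + rewrite th_thinv. ring.
  + ring.
Qed.

Lemma thpow_add (j k : Z) : thpow (j + k) = mul (thpow j) (thpow k).
Proof.
revert j; apply Z.bi_induction.
- intros i j ->. tauto.
- simpl. ring.
- intros j. rewrite Z.add_succ_l, !thpow_succ. split; intros E.
  + rewrite E. ring.
  + transitivity (mul thinv (mul th (thpow (j + k)))).
    * transitivity (mul (mul th thinv) (thpow (j + k))); [rewrite th_thinv|]; ring.
    * rewrite E. transitivity (mul (mul th thinv) (mul (thpow j) (thpow k)));
        [|rewrite th_thinv]; ring.
Qed.

Lemma norm_thpow (k : Z) : norm (thpow k) = 1.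
Proof.
revert k; apply Z.bi_induction; [intros i j ->; tauto|reflexivity|].
intros k. rewrite thpow_succ, norm_mul. change (norm th) with 1. lia.
Qed.

(** * Zeros of the recurrence *)

(* th^58 = 1 + 59 eta. *)
Definition eta : elt := let x := thpow 58 in Elt ((c0 x - 1) / 59) (c1 x / 59) (c2 x / 59).

(** Expansion of (1 + 59 eta)^k modulo 59^2, by induction from 0 in both directions. *)
Lemma thpow_58_mul (k : Z) :
  exists w, thpow (58 * k) =
    add (cst 1) (mul (cst 59) (add (mul (cst k) eta) (mul (cst 59) w))).
Proof.
assert (E : thpow 58 = add (cst 1) (mul (cst 59) eta)) by (vm_compute; reflexivity).
(* [w0] is the remainder in th^(-58) = 1 - 59 eta + 59^2 w0; the divisions are exact. *)
set (w0 := let x := thpow (-58) in Elt (((c0 x - 1) / 59 + c0 eta) / 59)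
   ((c1 x / 59 + c1 eta) / 59) ((c2 x / 59 + c2 eta) / 59)).
assert (E' : thpow (-58) =
  add (cst 1) (mul (cst 59) (add (opp eta) (mul (cst 59) w0))))
  by (vm_compute; reflexivity).
clearbody w0. generalize dependent eta. intros h E E'.
revert k; apply Z.bi_induction.
- intros i j ->. tauto.
- exists (cst 0). change (thpow (58 * 0)) with (cst 1). ring.
- intros k. split; intros [w Ew].
  + exists (add w (mul h (add (mul (cst k) h) (mul (cst 59) w)))).
    replace (58 * Z.succ k) with (58 * k + 58) by ring.
    rewrite thpow_add, Ew, E. unfold Z.succ. rewrite cst_add. ring.
  + exists (add (add w w0) (mul (add (opp h) (mul (cst 59) w0))
       (add (mul (cst (Z.succ k)) h) (mul (cst 59) w)))).
    replace (58 * k) with (58 * Z.succ k + -58) by ring.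
    rewrite thpow_add, Ew, E'. unfold Z.succ. rewrite cst_add. ring.
Qed.

(** Binomial expansion of (1 + q x)^n up to a multiple of q^3, with [t] equal to n choose 2. *)
Lemma thpow_mul_nat (j : Z) (q x : elt) (n : nat) :
  thpow j = add (cst 1) (mul q x) ->
  exists t w, 2 * t = Z.of_nat n * (Z.of_nat n - 1) /\
    thpow (j * Z.of_nat n) =
    add (add (cst 1) (mul (mul (cst (Z.of_nat n)) q) x))
      (add (mul (mul (mul q q) (cst t)) (mul x x)) (mul (mul q (mul q q)) w)).
Proof.
intros Ej. induction n as [|n [t [w [Et E]]]].
- exists 0, (cst 0). split; [reflexivity|].
  rewrite Z.mul_0_r. simpl. ring.
- exists (t + Z.of_nat n), (add w (add (mul (cst t) (mul x (mul x x))) (mul (mul q x) w))).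
  rewrite Nat2Z.inj_succ. split; [lia|].
  replace (j * Z.succ (Z.of_nat n)) with (j * Z.of_nat n + j) by ring.
  rewrite thpow_add, E, Ej. unfold Z.succ. rewrite !cst_add. ring.
Qed.

(** The 59th power gains one factor 59 and keeps the leading coefficient mod 59: 59 choose 2 is 59 *
    29, and the cubic remainder carries 59^3. *)
Lemma thpow_mul_59 (j r : Z) (x : elt) :
  thpow j = add (cst 1) (mul (cst (59 * r)) x) ->
  exists w, thpow (j * 59) =
    add (cst 1) (mul (cst (59 * (59 * r))) (add x (mul (cst 59) w))).
Proof.
intros Ej. destruct (thpow_mul_nat _ _ _ 59%nat Ej) as [t [w [Et E]]].
change (Z.of_nat 59) with 59 in *.
assert (t = 59 * 29) as -> by lia.
exists (add (mul (cst r) (mul (cst 29) (mul x x))) (mul (mul (cst r) (cst r)) w)).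
rewrite E, !cst_mul. ring.
Qed.

(* In the proof [r] is a power of 59: as [eta] is nonzero mod 59, [59 r] is the exact power of
   59 dividing th^(58 k) - 1, and the quotient is known mod 59. *)
Lemma thpow_58_expansion (k : Z) :
  k <> 0 ->
  exists r l w, r <> 0 /\ ~ (59 | l) /\
    thpow (58 * k) =
    add (cst 1) (mul (cst (59 * r)) (add (mul (cst l) eta) (mul (cst 59) w))).
Proof.
assert (H : forall n k, Z.abs k < Z.of_nat n -> k <> 0 ->
  exists r l w, r <> 0 /\ ~ (59 | l) /\
    thpow (58 * k) =
    add (cst 1) (mul (cst (59 * r)) (add (mul (cst l) eta) (mul (cst 59) w)))).
2:{ intros. apply (H (S (Z.to_nat (Z.abs k)))); lia. }
clear k. induction n as [|n IH]; intros k Hk k0; [lia|].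
destruct (Znumtheory.Zdivide_dec 59 k) as [[k' ->]|Hd].
- destruct (IH k') as [r [l [w [r0 [Hl E]]]]]; [lia|lia|].
  destruct (thpow_mul_59 _ _ _ E) as [w' E'].
  exists (59 * r), l, (add w w'). split; [lia|split; [exact Hl|]].
  rewrite Z.mul_assoc, E'. ring.
- destruct (thpow_58_mul k) as [w E].
  exists 1, k, w. split; [lia|split; [exact Hd|exact E]].
Qed.

(** Skolem's argument: for k <> 0 the expansion, divided by 59 r, gives l c2(x eta) = 0 mod 59 with
    l and c2(x eta) both prime to 59. *)
Lemma c2_thpow_58 (x : elt) (k : Z) :
  c2 x = 0 -> Z.gcd 59 (c2 (mul x eta)) = 1 ->
  c2 (mul x (thpow (58 * k))) = 0 -> k = 0.
Proof.
intros Hx Hg H0. destruct (Z.eq_dec k 0) as [|k0]; [assumption|exfalso].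
destruct (thpow_58_expansion k k0) as [r [l [w [r0 [Hl E]]]]].
apply Hl, (Z.gauss 59 (c2 (mul x eta)) l); [|assumption].
exists (- c2 (mul x w)).
rewrite E in H0.
replace (mul x _) with
  (add x (mul (cst (59 * r)) (add (mul (cst l) (mul x eta)) (mul (cst 59) (mul x w)))))
  in H0 by ring.
rewrite !c2_add, !c2_cst_mul, !c2_add, !c2_cst_mul, Hx in H0.
apply (Z.mul_reg_l _ _ (59 * r)); lia.
Qed.

Definition range (a : Z) (n : nat) : list Z := map (fun i => a + Z.of_nat i) (seq 0 n).

Lemma in_range (a : Z) (n : nat) (z : Z) : a <= z < a + Z.of_nat n -> In z (range a n).
Proof.
intros H. apply in_map_iff. exists (Z.to_nat (z - a)). split; [lia|].
apply in_seq. lia.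
Qed.

(** The first test finds every residue class mod 58 that can contain a zero and asks for a member of
    it in [s]; the second makes that member the only zero of its class. *)
Definition zeros_certificate (p : elt) (s : list Z) : bool :=
  forallb (fun r => implb (c2 (mul p (thpow r)) mod 59 =? 0)
                      (existsb (fun j => j mod 58 =? r) s)) (range 0 58) &&
  forallb (fun j => (c2 (mul p (thpow j)) =? 0) &&
                    (Z.gcd 59 (c2 (mul (mul p (thpow j)) eta)) =? 1)) s.

Lemma zeros_certificateP (p : elt) (s : list Z) (r : Z) :
  zeros_certificate p s = true -> c2 (mul p (thpow r)) = 0 -> In r s.
Proof.
intros Hc H0. apply andb_prop in Hc as [H1 H2]. rewrite forallb_forall in H1, H2.
assert (H58 : 58 <> 0) by lia.
assert (Hr : In (r mod 58) (range 0 58))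
  by (apply in_range; pose proof (Z.mod_pos_bound r 58); lia).
specialize (H1 _ Hr).
replace (c2 (mul p (thpow (r mod 58))) mod 59 =? 0) with true in H1.
- apply existsb_exists in H1 as [j [Hj Ej]]. apply Z.eqb_eq in Ej.
  specialize (H2 _ Hj). apply andb_prop in H2 as [H2 H3].
  apply Z.eqb_eq in H2, H3.
  assert (Er : r = j + 58 * (r / 58 - j / 58)).
  { pose proof (Z.div_mod r 58). pose proof (Z.div_mod j 58). lia. }
  rewrite Er in H0. rewrite thpow_add in H0.
  assert (E0 : r / 58 - j / 58 = 0).
  { apply (c2_thpow_58 (mul p (thpow j))); [assumption|assumption|].
    rewrite <- H0. f_equal. ring. }
  rewrite Er, E0, Z.add_0_r. exact Hj.
(* Since th^58 = 1 mod 59, a zero at r is a zero mod 59 at r mod 58. *)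
- symmetry. apply Z.eqb_eq.
  destruct (thpow_58_mul (r / 58)) as [w Ew].
  rewrite (Z.div_mod r 58 H58), Z.add_comm, thpow_add, Ew in H0.
  set (y := add (mul (cst (r / 58)) eta) (mul (cst 59) w)) in H0.
  replace (mul p _) with (add (mul p (thpow (r mod 58)))
    (mul (cst 59) (mul (mul p (thpow (r mod 58))) y))) in H0 by ring.
  rewrite c2_add, c2_cst_mul in H0. apply Z.mod_divide; [lia|].
  exists (- c2 (mul (mul p (thpow (r mod 58))) y)). lia.
Qed.

(** * Reduction by units *)

Definition ev (t : R) (x : elt) : R := (IZR (c0 x) + IZR (c1 x) * t + IZR (c2 x) * t ^ 2)%R.

Lemma ev_mul (t : R) (x y : elt) :
  (t ^ 3 = t + 1)%R -> ev t (mul x y) = (ev t x * ev t y)%R.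
Proof.
intros Ht. destruct x as [a b c], y as [d e f]. unfold ev, mul; cbn [c0 c1 c2].
repeat rewrite ?plus_IZR, ?mult_IZR.
apply Rminus_diag_uniq.
(* The difference of the two sides is this multiple of t + 1 - t^3. *)
transitivity ((t + 1 - t ^ 3) * (IZR b * IZR f + IZR c * IZR e + IZR c * IZR f * t))%R;
  [|rewrite Ht]; ring.
Qed.

(* The second factor is the squared modulus of the complex embedding of [x]: the complex conjugates
   of [t] have real part - t / 2 and squared imaginary part 3 t^2 / 4 - 1. *)
Lemma norm_ev (t : R) (x : elt) :
  (t ^ 3 = t + 1 ->
   IZR (norm x) = ev t x *
     ((IZR (c0 x) - IZR (c1 x) * t / 2 + IZR (c2 x) * (2 - t ^ 2) / 2) ^ 2 +
      (3 * t ^ 2 / 4 - 1) * (IZR (c1 x) - IZR (c2 x) * t) ^ 2))%R.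
Proof.
intros Ht. destruct x as [a b c]. unfold ev, norm; cbn [c0 c1 c2].
repeat rewrite ?plus_IZR, ?minus_IZR, ?mult_IZR.
apply Rminus_diag_uniq.
transitivity ((t + 1 - t ^ 3) * (IZR b ^ 3 - IZR b * IZR c ^ 2 - 3 * IZR a * IZR b * IZR c
  + IZR c ^ 3 * (t ^ 3 - t + 1)))%R; [field|rewrite Ht; ring].
Qed.

(** The plastic number 1.3247...; so narrow an interval makes the estimates of [box_bound]
    numerical. *)
Lemma real_root : exists t, (1.32 <= t <= 1.33 /\ t ^ 3 = t + 1)%R.
Proof.
destruct (IVT (fun t => t ^ 3 - t - 1)%R 1.32 1.33) as [t [Ht E]]; try lra.
- reg.
- exists t. split; [exact Ht|lra].
Qed.

Lemma thpow_reduction (t : R) (x : elt) :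
  (t ^ 3 = t + 1 -> 1 < t -> 0 < ev t x ->
   exists k, 1 <= ev t (mul x (thpow k)) <= t)%R.
Proof.
intros Ht t1 x0.
assert (Hk : forall k, ev t (thpow k) = exp (IZR k * ln t)).
{ apply Z.bi_induction; [intros i j ->; tauto| |].
  - rewrite Rmult_0_l, exp_0. unfold ev; simpl. ring.
  - intros k. rewrite thpow_succ, ev_mul, succ_IZR, Rmult_plus_distr_r, Rmult_1_l, exp_plus,
      exp_ln by lra.
    replace (ev t th) with t by (unfold ev; simpl; ring).
    split; intros E; [rewrite E; ring|].
    apply (Rmult_eq_reg_l t); lra. }
assert (L : (0 < ln t)%R) by (rewrite <- ln_1; apply ln_increasing; lra).
assert (exp_mono : forall a b, (a <= b -> exp a <= exp b)%R)
  by (intros a b [H| ->]; [left; apply exp_increasing, H|right; reflexivity]).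
(* With u = ln (ev t x) / ln t, this integer k satisfies 0 < u + k <= 1. *)
destruct (archimed (- (ln (ev t x) / ln t))) as [A B].
exists (up (- (ln (ev t x) / ln t))).
set (k := up _) in *. clearbody k.
rewrite ev_mul, Hk by exact Ht.
rewrite <- (exp_ln (ev t x)) at 1 2 by exact x0. rewrite <- exp_plus.
assert (E : (ln (ev t x) = ln (ev t x) / ln t * ln t)%R) by (field; lra).
set (u := (ln (ev t x) / ln t)%R) in *. clearbody u. rewrite E.
split.
- rewrite <- exp_0. apply exp_mono. nra.
- rewrite <- (exp_ln t) at 3 by lra. apply exp_mono. nra.
Qed.

(** The real embedding is at least 1, so the squared modulus of the complex one is at most 7; all
    embeddings are then bounded, hence also the coordinates. *)
Lemma box_bound (t : R) (x : elt) :
  (1.32 <= t <= 1.33 -> t ^ 3 = t + 1 -> 1 <= ev t x <= t -> IZR (norm x) <= 7 ->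
  -20 <= IZR (c0 x) <= 20 /\ -11 <= IZR (c1 x) <= 11 /\ -4 <= IZR (c2 x) <= 4)%R.
Proof.
intros t1 Ht Hx Hn. rewrite (norm_ev t x Ht) in Hn.
unfold ev in *. generalize dependent (norm x).
generalize dependent (IZR (c0 x)). intros a.
generalize dependent (IZR (c1 x)). intros b.
generalize dependent (IZR (c2 x)). intros c Hx Hn.
(* [u] is the real part of the complex embedding, and [v] its imaginary part up to the factor sqrt(3
   t^2 / 4 - 1). *)
set (u := (a - b * t / 2 + c * (2 - t ^ 2) / 2)%R) in *.
set (v := (b - c * t)%R) in *.
set (e := (a + b * t + c * t ^ 2)%R) in *.
assert (T2 : (1.7424 <= t ^ 2 <= 1.7689)%R) by nra.
assert (Hq : (u ^ 2 + (3 * t ^ 2 / 4 - 1) * v ^ 2 <= 7)%R).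
{ pose proof (pow2_ge_0 u). pose proof (pow2_ge_0 v). nra. }
assert (Hu : (-2.65 <= u <= 2.65)%R).
{ pose proof (pow2_ge_0 u). pose proof (pow2_ge_0 v). split; nra. }
assert (Hv : (-4.8 <= v <= 4.8)%R).
{ pose proof (pow2_ge_0 u). pose proof (pow2_ge_0 v). split; nra. }
(* The embeddings are inverted for c, b, a in turn; 3 t^2 - 1 is the derivative of t^3 - t - 1. *)
assert (Hc : (c * (3 * t ^ 2 - 1) = e - u - 3 / 2 * t * v)%R) by (unfold e, u, v; field).
assert (Hb : (b = c * t + v)%R) by (unfold v; ring).
assert (Ha : (a = e - b * t - c * t ^ 2)%R) by (unfold e; ring).
clearbody u v e.
assert (Htv : (-6.4 <= t * v <= 6.4)%R) by (split; nra).
assert (C : (-3.2 <= c <= 3.2)%R) by (split; nra).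
assert (Htc : (-4.256 <= c * t <= 4.256)%R) by (split; nra).
assert (B : (-9.1 <= b <= 9.1)%R) by lra.
assert (Htb : (-12.2 <= b * t <= 12.2)%R) by (split; nra).
assert (Hct : (-5.7 <= c * t ^ 2 <= 5.7)%R) by (split; nra).
repeat split; lra.
Qed.

Definition box : list elt :=
  flat_map (fun a => flat_map (fun b => map (Elt a b) (range (-4) 9)) (range (-11) 23))
    (range (-20) 41).

Definition elt_eqb (x y : elt) : bool :=
  (c0 x =? c0 y) && (c1 x =? c1 y) && (c2 x =? c2 y).

Lemma elt_eqbP (x y : elt) : elt_eqb x y = true -> x = y.
Proof.
destruct x, y. unfold elt_eqb; cbn [c0 c1 c2]. intros H.
apply andb_prop in H as [H H3]. apply andb_prop in H as [H1 H2].
apply Z.eqb_eq in H1, H2, H3. congruence.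
Qed.

Definition associates_certificate (p : elt) (r : list Z) : bool :=
  let s := map (fun j => mul p (thpow j)) r in
  forallb (fun x => implb (norm x =? norm p) (existsb (elt_eqb x) s)) box.

(** Positive norm makes the real embedding positive, so a power of th moves [x] into [box], where
    the search finds an associate of [p]. The unit -1 does not arise, as it negates the norm. *)
Lemma associates_certificateP (p x : elt) (r : list Z) :
  associates_certificate p r = true -> 0 < norm p <= 7 -> norm x = norm p ->
  exists k, x = mul p (thpow k).
Proof.
intros Hc Hp Hx.
destruct real_root as [t [t1 Ht]].
assert (x0 : (0 < ev t x)%R).
{ pose proof (norm_ev t x Ht) as E.
  set (q := (_ ^ 2 + _)%R) in E.
  assert (q0 : (0 <= q)%R).
  { unfold q. apply Rplus_le_le_0_compat; [apply pow2_ge_0|].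
    apply Rmult_le_pos; [nra|apply pow2_ge_0]. }
  clearbody q.
  assert (n0 : (0 < IZR (norm x))%R) by (apply IZR_lt; lia).
  nra. }
destruct (thpow_reduction t x Ht) as [k Hk]; [lra|assumption|].
set (y := mul x (thpow k)) in *.
assert (Hy : norm y = norm p) by (unfold y; rewrite norm_mul, norm_thpow; lia).
destruct (box_bound t y) as [B0 [B1 B2]]; try assumption.
{ apply IZR_le. lia. }
assert (Hbox : In y box).
{ destruct B0 as [A0 B0], B1 as [A1 B1], B2 as [A2 B2].
  apply le_IZR in A0, A1, A2, B0, B1, B2.
  apply in_flat_map. exists (c0 y). split; [apply in_range; lia|].
  apply in_flat_map. exists (c1 y). split; [apply in_range; lia|].
  apply in_map_iff. exists (c2 y). split; [destruct y; reflexivity|apply in_range; lia]. }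
unfold associates_certificate in Hc. rewrite forallb_forall in Hc.
specialize (Hc _ Hbox). rewrite Hy, Z.eqb_refl in Hc. simpl in Hc.
apply existsb_exists in Hc as [z [Hz E]]. apply elt_eqbP in E. subst z.
apply in_map_iff in Hz as [j [E _]].
exists (j + - k). rewrite thpow_add.
transitivity (mul y (thpow (- k))).
- unfold y. transitivity (mul x (mul (thpow k) (thpow (- k)))); [|ring].
  rewrite <- thpow_add, Z.add_opp_diag_r. simpl. ring.
- rewrite <- E. ring.
Qed.

(* The elements of [box] of norm 1, 5, 7 turn out to be [p] th^k with k from -22 to 14. *)
Lemma norm_form_solutions (p : elt) (s : list Z) (m n : Z) :
  associates_certificate p (range (-22) 37) = true -> zeros_certificate p s = true ->
  0 < norm p <= 7 -> m * m * m - m * n * n - n * n * n = norm p ->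
  In (Elt m (- n) 0) (map (fun j => mul p (thpow j)) s).
Proof.
intros Ha Hz Hp E.
destruct (associates_certificateP p (Elt m (- n) 0) _ Ha Hp) as [k Ek].
{ rewrite <- E. unfold norm; cbn [c0 c1 c2]. ring. }
rewrite Ek. apply in_map_iff. exists k. split; [reflexivity|].
apply (zeros_certificateP p s k Hz). rewrite <- Ek. reflexivity.
Qed.

(** * The Thue equations for 1, 5 and 7 *)

Ltac solve_norm_form p s E :=
  let H := fresh in
  assert (H := norm_form_solutions p s _ _
    ltac:(vm_compute; reflexivity) ltac:(vm_compute; reflexivity)
    ltac:(vm_compute; split; congruence) E);
  let l := eval vm_compute in (map (fun j => mul p (thpow j)) s) in
  match type of H with In ?x _ => change (In x l) in H end; simpl in H;
  repeat match type of H with _ \/ _ => destruct H as [H|H] end;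
  [injection H; lia ..|contradiction].

Lemma thue_1 (m n : Z) :
  m * m * m - m * n * n - n * n * n = 1 ->
  m = 4 /\ n = 3 \/ m = -1 /\ n = -1 \/ m = 0 \/ n = 0 \/ m + n = 0.
Proof.
(* th^(-13) = 4 - 3 th and th^(-4) = th - 1; the exponents 0, 1, 3 give n = 0, m = 0, m + n = 0. *)
intros E. solve_norm_form (cst 1) (-13 :: -4 :: 0 :: 1 :: 3 :: nil) E.
Qed.

Lemma thue_5 (m n : Z) :
  m * m * m - m * n * n - n * n * n = 5 ->
  m = 2 /\ n = 1 \/ m = 1 /\ n = -2.
Proof.
(* (2 - th) th^6 = 1 + 2 th. *)
intros E. solve_norm_form (Elt 2 (-1) 0) (0 :: 6 :: nil) E.
Qed.

Lemma thue_7 (m n : Z) :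
  m * m * m - m * n * n - n * n * n = 7 ->
  m = 3 /\ n = 2 \/ m = 2 /\ n = -1.
Proof.
(* (3 - 2 th) th^8 = 2 + th. *)
intros E. solve_norm_form (Elt 3 (-2) 0) (0 :: 8 :: nil) E.
Qed.

(** * Binary cubic forms without nontrivial zeros mod l *)

Definition anisotropic_certificate (l : nat) (a b c d : Z) : bool :=
  forallb (fun r => forallb (fun s =>
    implb ((a * r * r * r + b * r * r * s + c * r * s * s + d * s * s * s) mod (Z.of_nat l) =? 0)
      ((r =? 0) && (s =? 0))) (range 0 l)) (range 0 l).

Lemma anisotropic_certificateP (l : nat) (a b c d m n : Z) :
  (0 < l)%nat -> anisotropic_certificate l a b c d = true ->
  a * m * m * m + b * m * m * n + c * m * n * n + d * n * n * n = 0 ->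
  (Z.of_nat l | m) /\ (Z.of_nat l | n).
Proof.
intros l0 H E. unfold anisotropic_certificate in H.
assert (L : 0 < Z.of_nat l) by lia. set (p := Z.of_nat l) in *.
assert (Hr : forall z, In (z mod p) (range 0 l)).
{ intros z. apply in_range. pose proof (Z.mod_pos_bound z p L). lia. }
rewrite forallb_forall in H. specialize (H _ (Hr m)).
rewrite forallb_forall in H. specialize (H _ (Hr n)).
replace (_ mod p) with 0 in H.
- simpl in H. apply andb_prop in H as [Hm Hn]. apply Z.eqb_eq in Hm, Hn.
  split; apply Z.mod_divide; lia.
- rewrite <- (Z.mod_0_l p) by lia. rewrite <- E. apply eqm_sym.
  repeat (apply Zplus_eqm || apply Zmult_eqm || apply Zmod_eqm || reflexivity).
Qed.

End CubicRing.

From mathcomp Require Import all_boot all_order all_algebra.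
From mathcomp Require Import ssrZ zify ring.
Import GRing.Theory Num.Theory.
Local Open Scope ring_scope.

(** * Rational 3-cycles *)

Definition numer_form (m n : int) : int := m * m * m - m * n * n - n * n * n.

(** The form is odd, so (-m, -n) reduces the negative value to the positive one. *)
Lemma numer_form_1 (m n : int) :
  0 < n -> numer_form m n = 1 \/ numer_form m n = - 1 ->
  m = 4 /\ n = 3 \/ m = 1 /\ n = 1 \/ m = 0 \/ m + n = 0.
Proof.
have := CubicRing.thue_1 (Z_of_int m) (Z_of_int n).
have := CubicRing.thue_1 (Z.opp (Z_of_int m)) (Z.opp (Z_of_int n)).
rewrite /numer_form; lia.
Qed.

Lemma numer_form_5 (m n : int) :
  0 < n -> numer_form m n = 5 \/ numer_form m n = - 5 ->
  m = 2 /\ n = 1 \/ m = - 1 /\ n = 2.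
Proof.
have := CubicRing.thue_5 (Z_of_int m) (Z_of_int n).
have := CubicRing.thue_5 (Z.opp (Z_of_int m)) (Z.opp (Z_of_int n)).
rewrite /numer_form; lia.
Qed.

Lemma numer_form_7 (m n : int) :
  0 < n -> numer_form m n = 7 \/ numer_form m n = - 7 ->
  m = 3 /\ n = 2 \/ m = - 2 /\ n = 1.
Proof.
have := CubicRing.thue_7 (Z_of_int m) (Z_of_int n).
have := CubicRing.thue_7 (Z.opp (Z_of_int m)) (Z.opp (Z_of_int n)).
rewrite /numer_form; lia.
Qed.

Lemma coprimez_MDl (q d b : int) : coprimez b d -> coprimez (q * d + b) d.
Proof. by rewrite ![coprimez _ d]coprimez_sym /coprimez gcdzMDl. Qed.

(** The form is -n^3 mod m, and m^3 mod n and mod m + n. As m n (m + n) is even, the factor 2 adds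
    no new prime. *)
Lemma coprimez_numer_form (m n : int) :
  coprimez m n -> coprimez (numer_form m n) (2 * m * n * (m + n)).
Proof.
move=> mn.
have nm : coprimez n m by rewrite coprimez_sym.
have mD : coprimez m (m + n).
  by rewrite coprimez_sym -[m in m + n]mul1r coprimez_MDl.
have Fm : coprimez (numer_form m n) m.
  have -> : numer_form m n = (m * m - n * n) * m + (- n) ^+ 3 by rewrite /numer_form; ring.
  by rewrite coprimez_MDl // coprimezXl // /coprimez gcdNz.
have Fn : coprimez (numer_form m n) n.
  have -> : numer_form m n = (- m * n - n * n) * n + m ^+ 3 by rewrite /numer_form; ring.
  by rewrite coprimez_MDl // coprimezXl.
have FD : coprimez (numer_form m n) (m + n).
  have -> : numer_form m n = (- n * n) * (m + n) + m ^+ 3 by rewrite /numer_form; ring.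
  by rewrite coprimez_MDl // coprimezXl.
have F0 : coprimez (numer_form m n) (m * n * (m + n)) by rewrite !coprimezMr Fm Fn.
rewrite -!mulrA coprimezMr mulrA F0 andbT.
have : (2 %| m * n * (m + n))%Z.
  rewrite dvdzE !abszM dvdn2 !oddM.
  case: (boolP (odd `|m|)) => //= om; case: (boolP (odd `|n|)) => //= on; lia.
move=> /dvdzP [q E]; move: F0; rewrite E.
by rewrite coprimezMr => /andP [].
Qed.

Lemma numq_div_numer_form (m n : int) :
  coprimez m n -> 2 * m * n * (m + n) != 0 ->
  numq ((numer_form m n)%:~R / (2 * m * n * (m + n))%:~R) = numer_form m n \/
  numq ((numer_form m n)%:~R / (2 * m * n * (m + n))%:~R) = - numer_form m n.
Proof.
move=> mn d0; rewrite coprimeq_num; last exact: coprimez_numer_form.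
by rewrite /Num.sg (negPf d0); case: ifP; rewrite ?mulN1r ?mul1r; [right|left].
Qed.

(** Differences of consecutive equations give t (x1 - x2) = x2 - x3 and (x2 + x3) (x2 - x3) = x3 -
    x1; none of the differences vanishes, and the rest is linear in x2. *)
Lemma cycle_param (c x1 x2 x3 : rat) (t := x1 + x2) :
  is_3cycle c x1 x2 x3 ->
  [/\ t != 0, t + 1 != 0, x2 = (t ^+ 3 - t - 1) / (2 * t * (t + 1)) &
      x2 + x3 = - (t + 1) / t].
Proof.
rewrite /is_3cycle /fc => -[/= E1 E2 E3 [d12 d23 d13]].
have d0 : x1 - x2 != 0 by rewrite subr_eq0.
have Et : t * (x1 - x2) = x2 - x3.
  transitivity ((x1 ^+ 2 + c) - (x2 ^+ 2 + c)); first by rewrite /t; ring.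
  by rewrite E1 E2.
have t0 : t != 0.
  by apply: contra_neq d23 => t0; apply/eqP; rewrite -subr_eq0 -Et t0 mul0r.
have Eu : (t + 1) * (x1 - x2) = x1 - x3 by rewrite mulrDl Et; ring.
have t1 : t + 1 != 0.
  by apply: contra_neq d13 => t1; apply/eqP; rewrite -subr_eq0 -Eu t1 mul0r.
have E : x2 + x3 = - (t + 1) / t.
  apply: (mulfI t0); apply: (mulIf d0).
  transitivity ((x2 + x3) * (t * (x1 - x2))); first by ring.
  transitivity (- ((t + 1) * (x1 - x2))); last by field.
  rewrite Et Eu; transitivity ((x2 ^+ 2 + c) - (x3 ^+ 2 + c)); first by ring.
  by rewrite E2 E3; ring.
split=> //.
have Eu' : t * (x2 + x3) + (t + 1) = 0 by rewrite E; field.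
have Et' : x2 - x3 - t * (x1 - x2) = 0 by rewrite Et subrr.
apply: (@mulIf _ (2 * t * (t + 1))); first by rewrite !mulf_neq0.
rewrite divfK ?mulf_neq0 //.
transitivity (t ^+ 3 - t - 1 + t * (x2 - x3 - t * (x1 - x2)) + (t * (x2 + x3) + (t + 1))).
  by rewrite /t; ring.
by rewrite Et' Eu'; ring.
Qed.

(* x3 - x2^2, with x2 and x2 + x3 expressed through t = x1 + x2. *)
Definition cycle_c (t : rat) : rat :=
  - (t + 1) / t - (t ^+ 3 - t - 1) / (2 * t * (t + 1)) -
  ((t ^+ 3 - t - 1) / (2 * t * (t + 1))) ^+ 2.

Lemma cycle_c_value (c x1 x2 x3 : rat) :
  is_3cycle c x1 x2 x3 -> c = cycle_c (x1 + x2).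
Proof.
move=> cyc; have [t0 t1 E2 E23] := cycle_param _ _ _ _ cyc.
rewrite /cycle_c -E2 -E23; case: cyc => _ <- _ _; rewrite /fc; ring.
Qed.

(** Substituting t = m / n in the formula for x2 gives a fraction already in lowest terms. *)
Lemma cycle_numer_form (c x1 x2 x3 : rat) (k : int) :
  is_3cycle c x1 x2 x3 -> has_numer k x2 ->
  let m := numq (x1 + x2) in let n := denq (x1 + x2) in
  [/\ 0 < n, m != 0, m + n != 0, c = cycle_c (m%:~R / n%:~R) &
      numer_form m n = k \/ numer_form m n = - k].
Proof.
move=> cyc Hk m n; have [t0 t1 E2 E23] := cycle_param _ _ _ _ cyc.
have c_t := cycle_c_value _ _ _ _ cyc.
have Et : x1 + x2 = m%:~R / n%:~R by rewrite divq_num_den.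
have n0 : 0 < n by exact: denq_gt0.
have nR0 : n%:~R != 0 :> rat by rewrite intr_eq0 lt0r_neq0.
have m0 : m != 0 by rewrite numq_eq0.
have mR0 : m%:~R != 0 :> rat by rewrite intr_eq0.
have mnR : (m + n)%:~R != 0 :> rat.
  apply: contra_neq t1 => mn0; rewrite Et; apply: (mulIf nR0).
  by rewrite mul0r mulrDl divfK // mul1r -intrD.
have mn0 : m + n != 0 by rewrite -(intr_eq0 rat).
split=> //; first by rewrite -Et.
have mn : coprimez m n by rewrite /coprimez; have := coprime_num_den (x1 + x2).
have D0 : 2 * m * n * (m + n) != 0 by rewrite !mulf_neq0 // lt0r_neq0.
have E2' : x2 = (numer_form m n)%:~R / (2 * m * n * (m + n))%:~R.
  rewrite E2 Et /numer_form !rmorphB !rmorphM !rmorphD /=.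
  rewrite rmorphD /= in mnR.
  by field; rewrite mR0 nR0 mnR.
have := numq_div_numer_form m n mn D0; rewrite -E2'.
by case: Hk => -> [] E; [left|right|right|left]; lia.
Qed.

(** A root m / n would be a zero of the homogenized form, so p would divide both m and n. *)
Lemma cubic_no_root (p : nat) (a b c d : int) (t : rat) :
  (1 < p)%N ->
  CubicRing.anisotropic_certificate p (Z_of_int a) (Z_of_int b) (Z_of_int c)
    (Z_of_int d) = true ->
  a%:~R * t ^+ 3 + b%:~R * t ^+ 2 + c%:~R * t + d%:~R != 0.
Proof.
move=> p1 cert; apply/eqP => E.
set m := numq t; set n := denq t.
have nR0 : n%:~R != 0 :> rat by rewrite intr_eq0 denq_neq0.
have Et : t = m%:~R / n%:~R by rewrite divq_num_den.
have /eqP : (a * m * m * m + b * m * m * n + c * m * n * n + d * n * n * n)%:~R = 0 :> rat.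
  rewrite !(rmorphD, rmorphM) /= -[RHS](mul0r (n%:~R ^+ 3)) -E Et.
  by field.
rewrite intr_eq0 => /eqP EZ.
have := CubicRing.anisotropic_certificateP p _ _ _ _ (Z_of_int m) (Z_of_int n) _ cert.
case; [lia|lia|move=> pm pn].
have dvd (z : int) : Z.divide (Z.of_nat p) (Z_of_int z) -> (p %| `|z|)%N.
  case=> q Eq; apply/dvdnP; exists (absz (int_of_Z q)); lia.
have : (p %| gcdn `|m| `|n|)%N by rewrite dvdn_gcd !dvd.
by rewrite (eqP (coprime_num_den t)) dvdn1 => /eqP Ep; rewrite Ep in p1.
Qed.

Lemma cycle_rot (c x1 x2 x3 : rat) : is_3cycle c x1 x2 x3 -> is_3cycle c x2 x3 x1.
Proof.
by case=> E1 E2 E3 [d12 d23 d13]; split=> //; split; rewrite // eq_sym.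
Qed.

Lemma cycle_sum (c x1 x2 x3 : rat) (t := x1 + x2) (s := x1 + x2 + x3) :
  is_3cycle c x1 x2 x3 ->
  t ^+ 3 - 3 * t - 1 = 2 * s * (t * (t + 1)) /\ s ^+ 2 + s + c + 2 = 0.
Proof.
move=> cyc; have [] := cycle_param _ _ _ _ cyc; have := cycle_c_value _ _ _ _ cyc.
rewrite -/t => Ec t0 t1 E2 E23.
have Es : s = t - (t + 1) / t - (t ^+ 3 - t - 1) / (2 * t * (t + 1)).
  by rewrite -E2 -mulNr -E23 /s /t; ring.
by split; rewrite ?Ec Es /cycle_c; field; rewrite t0 t1.
Qed.

(** The quadratic has the roots s and -1 - s; the last hypothesis rules out -1 - s as the sum of the
    cycle. *)
Lemma cycle_cubic (c x1 x2 x3 s : rat) (t := x1 + x2) :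
  is_3cycle c x1 x2 x3 -> s ^+ 2 + s + c + 2 = 0 ->
  t ^+ 3 - 3 * t - 1 + 2 * (1 + s) * (t * (t + 1)) != 0 ->
  t ^+ 3 - 3 * t - 1 = 2 * s * (t * (t + 1)).
Proof.
move=> cyc Es /negP nroot; have [-> Es'] := cycle_sum _ _ _ _ cyc.
have /eqP : (x1 + x2 + x3 - s) * (x1 + x2 + x3 + 1 + s) = 0.
  by rewrite -[RHS](subrr 0) -{1}Es' -Es; ring.
rewrite mulf_eq0 => /orP [/eqP H | /eqP H]; first by rewrite (subr0_eq H).
case: nroot; apply/eqP; have [-> _] := cycle_sum _ _ _ _ cyc.
by rewrite (_ : 1 + s = - (x1 + x2 + x3)) ?/t; [ring|rewrite -[LHS]subr0 -H; ring].
Qed.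

Lemma cycle_points (c x1 x2 x3 t : rat) :
  is_3cycle c x1 x2 x3 -> x1 + x2 = t ->
  [/\ x1 = t - (t ^+ 3 - t - 1) / (2 * t * (t + 1)),
      x2 = (t ^+ 3 - t - 1) / (2 * t * (t + 1)) &
      x3 = - (t + 1) / t - (t ^+ 3 - t - 1) / (2 * t * (t + 1))].
Proof.
move=> cyc Et; have [_ _] := cycle_param _ _ _ _ cyc; rewrite Et => <- <-.
by split=> //; rewrite -?Et; ring.
Qed.

(** * Values of c forced by a numerator *)

Lemma cycle_numer_1 (c x1 x2 x3 : rat) :
  is_3cycle c x1 x2 x3 -> has_numer 1 x2 ->
  c = - (29%:R / 16%:R) \/ c = - ((29 * 1709)%:R / (2 ^ 6 * 3 ^ 2 * 7 ^ 2)%:R).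
Proof.
move=> cyc /(cycle_numer_form _ _ _ _ _ cyc) [n0 m0 mn0 -> E].
(* The cases are t = 4/3, t = 1 and the excluded t = 0, t = -1. *)
case: (numer_form_1 _ _ n0 E) => [|[|[]]] => [[-> ->]|[-> ->]|H|H].
- by right; rewrite /cycle_c; field.
- by left; rewrite /cycle_c; field.
- by case/eqP: m0.
- by case/eqP: mn0.
Qed.

Lemma cycle_numer_5 (c x1 x2 x3 : rat) :
  is_3cycle c x1 x2 x3 -> has_numer 5 x2 ->
  c = - (29%:R / 16%:R) \/ c = - (301%:R / (2 ^ 4 * 3 ^ 2)%:R).
Proof.
move=> cyc /(cycle_numer_form _ _ _ _ _ cyc) [n0 _ _ -> E].
case: (numer_form_5 _ _ n0 E) => -[-> ->].
- by right; rewrite /cycle_c; field.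
- by left; rewrite /cycle_c; field.
Qed.

Lemma cycle_numer_7 (c x1 x2 x3 : rat) :
  is_3cycle c x1 x2 x3 -> has_numer 7 x2 ->
  c = - (29%:R / 16%:R) \/ c = - (6469%:R / (2 ^ 4 * 3 ^ 2 * 5 ^ 2)%:R).
Proof.
move=> cyc /(cycle_numer_form _ _ _ _ _ cyc) [n0 _ _ -> E].
case: (numer_form_7 _ _ n0 E) => -[-> ->].
- by right; rewrite /cycle_c; field.
- by left; rewrite /cycle_c; field.
Qed.

(** Rotation brings the point with the given numerator to the middle. *)
Lemma some_numer_cycle (P : Prop) (k : int) (c x1 x2 x3 : rat) :
  (forall y1 y2 y3, is_3cycle c y1 y2 y3 -> has_numer k y2 -> P) ->
  is_3cycle c x1 x2 x3 -> some_numer k x1 x2 x3 -> P.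
Proof.
move=> H cyc; have cyc' := cycle_rot _ _ _ _ cyc; have cyc'' := cycle_rot _ _ _ _ cyc'.
by case=> [|[]]; [apply: H cyc''|apply: H cyc|apply: H cyc'].
Qed.

(** * Numerators forced by c *)

Lemma cycle_orbit (c x1 x2 x3 s t1 t2 t3 : rat) :
  is_3cycle c x1 x2 x3 -> s ^+ 2 + s + c + 2 = 0 ->
  (forall t, t ^+ 3 - 3 * t - 1 + 2 * (1 + s) * (t * (t + 1)) != 0) ->
  (forall t, t ^+ 3 - 3 * t - 1 - 2 * s * (t * (t + 1)) = (t - t1) * (t - t2) * (t - t3)) ->
  [\/ x1 + x2 = t1, x1 + x2 = t2 | x1 + x2 = t3].
Proof.
move=> cyc Es nroot factor.
have E := cycle_cubic _ _ _ _ _ cyc Es (nroot _).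
have /eqP := factor (x1 + x2); rewrite E subrr eq_sym !mulf_eq0 !subr_eq0.
by case/orP => [/orP [] | ] /eqP ->; [constructor 1|constructor 2|constructor 3].
Qed.

Ltac compute_numers cyc :=
  move=> /(cycle_points _ _ _ _ _ cyc) [-> -> ->];
  rewrite /some_numer /has_numer; vm_compute; tauto.

Lemma cycle_29_16 (c x1 x2 x3 : rat) :
  is_3cycle c x1 x2 x3 -> c = - (29%:R / 16%:R) ->
  some_numer 1 x1 x2 x3 /\ some_numer 5 x1 x2 x3 /\ some_numer 7 x1 x2 x3.
Proof.
(* The sum of the cycle 5/4, -1/4, -7/4, whose pair sums are 1, -2, -1/2. *)
move=> cyc Ec; set s : rat := - (3 / 4).
have {Ec} Es : s ^+ 2 + s + c + 2 = 0 by rewrite {}Ec /s; field.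
case: (cycle_orbit _ _ _ _ s 1 (- 2) (- (1 / 2)) cyc Es); rewrite /s {Es s};
  [ | by move=> t; field | compute_numers cyc ..].
(* Twice the cubic for the other sum, -1/4. *)
move=> t; have := cubic_no_root 11 2 1 (- 5) (- 2) t isT erefl.
by apply: contra_neq => E; rewrite -[RHS](mulr0 2) -E; field.
Qed.

Lemma cycle_49561_28224 (c x1 x2 x3 : rat) :
  is_3cycle c x1 x2 x3 -> c = - ((29 * 1709)%:R / (2 ^ 6 * 3 ^ 2 * 7 ^ 2)%:R) ->
  some_numer 1 x1 x2 x3.
Proof.
(* From the cycle 223/168, 1/168, -295/168. *)
move=> cyc Ec; set s : rat := - (71 / 168).
have {Ec} Es : s ^+ 2 + s + c + 2 = 0 by rewrite {}Ec /s; field.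
case: (cycle_orbit _ _ _ _ s (4 / 3) (- (7 / 4)) (- (3 / 7)) cyc Es); rewrite /s {Es s};
  [ | by move=> t; field | compute_numers cyc ..].
move=> t; have := cubic_no_root 11 84 97 (- 155) (- 84) t isT erefl.
by apply: contra_neq => E; rewrite -[RHS](mulr0 84) -E; field.
Qed.

Lemma cycle_301_144 (c x1 x2 x3 : rat) :
  is_3cycle c x1 x2 x3 -> c = - (301%:R / (2 ^ 4 * 3 ^ 2)%:R) ->
  some_numer 5 x1 x2 x3.
Proof.
(* From the cycle 19/12, 5/12, -23/12. *)
move=> cyc Ec; set s : rat := 1 / 12.
have {Ec} Es : s ^+ 2 + s + c + 2 = 0 by rewrite {}Ec /s; field.
case: (cycle_orbit _ _ _ _ s 2 (- (3 / 2)) (- (1 / 3)) cyc Es); rewrite /s {Es s};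
  [ | by move=> t; field | compute_numers cyc ..].
move=> t; have := cubic_no_root 11 6 13 (- 5) (- 6) t isT erefl.
by apply: contra_neq => E; rewrite -[RHS](mulr0 6) -E; field.
Qed.

Lemma cycle_6469_3600 (c x1 x2 x3 : rat) :
  is_3cycle c x1 x2 x3 -> c = - (6469%:R / (2 ^ 4 * 3 ^ 2 * 5 ^ 2)%:R) ->
  some_numer 7 x1 x2 x3.
Proof.
(* From the cycle 83/60, 7/60, -107/60. *)
move=> cyc Ec; set s : rat := - (17 / 60).
have {Ec} Es : s ^+ 2 + s + c + 2 = 0 by rewrite {}Ec /s; field.
case: (cycle_orbit _ _ _ _ s (3 / 2) (- (5 / 3)) (- (2 / 5)) cyc Es); rewrite /s {Es s};
  [ | by move=> t; field | compute_numers cyc ..].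
move=> t; have := cubic_no_root 11 30 43 (- 47) (- 30) t isT erefl.
by apply: contra_neq => E; rewrite -[RHS](mulr0 30) -E; field.
Qed.

Theorem theorem7 (c x1 x2 x3 : rat) :
  is_3cycle c x1 x2 x3 ->
  [/\ some_numer 1 x1 x2 x3 <->
        (c = - (29%:R / 16%:R) \/
         c = - ((29 * 1709)%:R / (2 ^ 6 * 3 ^ 2 * 7 ^ 2)%:R)),
      some_numer 5 x1 x2 x3 <->
        (c = - (29%:R / 16%:R) \/
         c = - (301%:R / (2 ^ 4 * 3 ^ 2)%:R)) &
      some_numer 7 x1 x2 x3 <->
        (c = - (29%:R / 16%:R) \/
         c = - (6469%:R / (2 ^ 4 * 3 ^ 2 * 5 ^ 2)%:R))].
Proof.
move=> cyc; split; split.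
- by apply: some_numer_cycle cyc => *; apply: cycle_numer_1; eassumption.
- by case=> [/(cycle_29_16 _ _ _ _ cyc) [] | /(cycle_49561_28224 _ _ _ _ cyc)].
- by apply: some_numer_cycle cyc => *; apply: cycle_numer_5; eassumption.
- by case=> [/(cycle_29_16 _ _ _ _ cyc) [_ []] | /(cycle_301_144 _ _ _ _ cyc)].
- by apply: some_numer_cycle cyc => *; apply: cycle_numer_7; eassumption.
- by case=> [/(cycle_29_16 _ _ _ _ cyc) [_ []] | /(cycle_6469_3600 _ _ _ _ cyc)].
Qed.
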